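(* Let $(G,m,w,B)$ be a connected weighted finite graph with boundary, with vertex set $V$ and interior $\Omega=V\setminus B$, and suppose that there is a positive constant $\rho$ such that $w_{xy}=\rho m_x m_y$ for each $x\in B$ and $y\in\Omega$. Let $V_B=\sum_{x\in B}m_x$ and $V_\Omega=\sum_{y\in\Omega}m_y$, let $\mu_i$ and $\sigma_i$ be the Laplacian and Steklov eigenvalues of $(G,m,w,B)$, and let $\mu_2(\Omega)$ be the second Laplacian eigenvalue of the induced graph of $G$ on $\Omega$. Then $\sigma_i=\mu_i$ for all $i=1,2,\dots,|B|$ if and only if $$\rho\,(V_\Omega-V_B)\le\mu_2(\Omega).$$ In particular, if the induced graph on $\Omega$ is disconnected, then $\sigma_i=\mu_i$ for all $i=1,2,\dots,|B|$ if and only if $V_B\ge V_\Omega$.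
   Context: A weighted graph $(G,m,w)$ consists of a finite, simple, connected graph $G$ with vertex set $V$ and edge set $E$, a positive function $m$ on $V$ (vertex measure, written $m_x$), and a positive function $w$ on $E$ (edge weight), regarded as a symmetric function $w_{xy}$ on $V\times V$ by setting $w_{xy}=0$ when $\{x,y\}\notin E$. Graph with boundary: $(G,m,w,B)$ is a weighted graph together with a set $B\subset V$ (the vertex-boundary) such that no two vertices of $B$ are adjacent and every vertex of $B$ is adjacent to some vertex of $\Omega:=V\setminus B$ (the vertex-interior). Laplacian: for $u\in\mathbb{R}^V$, $\Delta u(x)=\frac1{m_x}\sum_{y\in V}(u(y)-u(x))w_{xy}$. The operator $-\Delta$ is nonnegative and self-adjoint for $\langle u,v\rangle=\sum_{x\in V}u(x)v(x)m_x$; its eigenvalues, counted with multiplicity, are $0=\mu_1<\mu_2\le\cdots\le\mu_{|V|}$. Steklov eigenvalues: for $f\in\mathbb{R}^B$ let $u_f\in\mathbb{R}^V$ be the harmonic extension of $f$, that is, $u_f=f$ on $B$ and $\Delta u_f=0$ on $\Omega$. The Dirichlet-to-Neumann map $\Lambda:\mathbb{R}^B\to\mathbb{R}^B$ is $\Lambda(f)=\frac{\partial u_f}{\partial n}$, where $\frac{\partial u}{\partial n}(x)=\frac1{m_x}\sum_{y\in V}(u(x)-u(y))w_{xy}$ for $x\in B$. It is nonnegative and self-adjoint for $\langle f,g\rangle_B=\sum_{x\in B}f(x)g(x)m_x$; its eigenvalues, counted with multiplicity, are $0=\sigma_1<\sigma_2\le\cdots\le\sigma_{|B|}$. The induced graph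 on $\Omega$ has vertex set $\Omega$, the edges of $G$ with both endpoints in $\Omega$, and the restrictions of $m$ and $w$; it need not be connected. $\mu_2(\Omega)$ is the second smallest eigenvalue (with multiplicity) of its Laplacian $u\mapsto -\frac{1}{m_x}\sum_{y\in\Omega}(u(y)-u(x))w_{xy}$ on $\mathbb{R}^\Omega$.
   Formalization: Assumes that B has at least two vertices: for |B|=1 both equivalences can fail, e.g. for the star with two leaves, unit measure and weights, and B its centre; when Ω is a single vertex, μ_2(Ω) is taken to be +∞. *)

(* Defs.v *)
From HB Require Import structures.
From mathcomp Require Import all_boot all_order all_algebra.
From mathcomp Require Import polyrcf.
From mathcomp Require Import boolp classical_sets reals constructive_ereal.

Set Implicit Arguments.
Unset Strict Implicit.
Unset Printing Implicit Defensive.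
Import Order.TTheory GRing.Theory Num.Theory.
Import passmx.
Local Open Scope ring_scope.

(* Connectedness is a separate predicate, so that induced subgraphs, which
   need not be connected, are weighted graphs of the same type. *)
Record wgraph (R : realType) (V : finType) := WGraph {
  adj : rel V;
  vmeas : V -> R;
  ewt : V -> V -> R;
  adj_sym : forall x y, adj x y = adj y x;
  adj_irr : forall x, ~~ adj x x;
  vmeas_gt0 : forall x, 0 < vmeas x;
  ewt_sym : forall x y, ewt x y = ewt y x;
  ewt_gt0 : forall x y, adj x y -> 0 < ewt x y;
  ewt_eq0 : forall x y, ~~ adj x y -> ewt x y = 0
}.

Definition graph_connected (R : realType) (V : finType) (G : wgraph R V) : Prop :=
  forall x y, connect (adj G) x y.

(* With interior ~: B. *)
Definition vertex_boundary (R : realType) (V : finType) (G : wgraph R V)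
    (B : {set V}) : Prop :=
  (forall x y, x \in B -> y \in B -> ~~ adj G x y) /\
  (forall x, x \in B -> exists2 y, y \in ~: B & adj G x y).

Definition induced (R : realType) (V : finType) (G : wgraph R V) (A : {set V}) :
    wgraph R {x : V | x \in A} :=
  @WGraph R {x : V | x \in A}
    (fun x y => adj G (val x) (val y))
    (fun x => vmeas G (val x))
    (fun x y => ewt G (val x) (val y))
    (fun x y => adj_sym G (val x) (val y))
    (fun x => adj_irr G (val x))
    (fun x => vmeas_gt0 G (val x))
    (fun x y => ewt_sym G (val x) (val y))
    (fun x y => @ewt_gt0 R V G (val x) (val y))
    (fun x y => @ewt_eq0 R V G (val x) (val y)).

(* All eigenvalues of f in nondecreasing order, each repeated as often as the
   dimension of its eigenspace; see eigenvalues_sorted, count_eigenvalues. *)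
Definition eigenvalues (R : realType) (U : vectType R) (f : 'End(U)) : seq R :=
  flatten [seq nseq (\dim (leigenspace f a)) a
          | a <- rootsR (char_poly (mxof (vbasis {:U}) (vbasis {:U}) f))].

(* The i-th smallest eigenvalue, counting from i = 1. *)
Definition eigval (R : realType) (U : vectType R) (f : 'End(U)) (i : nat) : R :=
  nth 0 (eigenvalues f) i.-1.

Definition laplacian (R : realType) (V : finType) (G : wgraph R V)
    (u : {ffun V -> R^o}) : {ffun V -> R^o} :=
  [ffun x => (vmeas G x)^-1 * \sum_y (u y - u x) * ewt G x y].

Definition laplace_eigval (R : realType) (V : finType) (G : wgraph R V)
    (i : nat) : R :=
  eigval (linfun (fun u => - laplacian G u)) i.

Definition normal_derivative (R : realType) (V : finType) (G : wgraph R V)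
    (u : {ffun V -> R^o}) (x : V) : R :=
  (vmeas G x)^-1 * \sum_y (u x - u y) * ewt G x y.

Definition is_harmonic_extension (R : realType) (V : finType) (G : wgraph R V)
    (B : {set V}) (f : {ffun {x : V | x \in B} -> R^o})
    (u : {ffun V -> R^o}) : Prop :=
  (forall x : {x : V | x \in B}, u (val x) = f x) /\
  (forall x, x \in ~: B -> laplacian G u x = 0).

(* On a connected graph with nonempty B the extension exists and is unique, so
   that it does not depend on the choice made here and is linear in f. *)
Definition harmonic_extension (R : realType) (V : finType) (G : wgraph R V)
    (B : {set V}) (f : {ffun {x : V | x \in B} -> R^o}) : {ffun V -> R^o} :=
  xget 0 [set u | is_harmonic_extension G f u]%classic.

Definition dirichlet_to_neumann (R : realType) (V : finType) (G : wgraph R V)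
    (B : {set V}) (f : {ffun {x : V | x \in B} -> R^o}) :
    {ffun {x : V | x \in B} -> R^o} :=
  [ffun x => normal_derivative G (harmonic_extension G f) (val x)].

Definition steklov_eigval (R : realType) (V : finType) (G : wgraph R V)
    (B : {set V}) (i : nat) : R :=
  eigval (linfun (@dirichlet_to_neumann R V G B)) i.

(* The second Laplacian eigenvalue; a graph with fewer than two vertices has
   none, and then the value is +oo (the infimum over an empty set). *)
Definition mu2 (R : realType) (V : finType) (G : wgraph R V) : \bar R :=
  if (1 < #|V|)%N then (laplace_eigval G 2)%:E else +oo%E.

Lemma eigenvalues_sorted (R : realType) (U : vectType R) (f : 'End(U)) :
  sorted <=%R (eigenvalues f).
Proof.
rewrite /eigenvalues.
have : sorted <%R (rootsR (char_poly (mxof (vbasis {:U}) (vbasis {:U}) f))) by exact: sorted_roots.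
elim: (rootsR _) => //= a s IHs sas.
have ss : sorted <%R s by exact: path_sorted sas.
have le_as : all (>= a) (flatten [seq nseq (\dim (leigenspace f b)) b | b <- s]).
  apply/allP => c /flatten_mapP[b bs]; rewrite mem_nseq => /andP[_ /eqP ->].
  by apply/ltW/(allP (order_path_min lt_trans sas)).
elim: (\dim _) => /= [|n IHn]; first exact: IHs.
rewrite path_min_sorted //; rewrite all_cat le_as andbT.
by apply/allP => c; rewrite mem_nseq => /andP[_ /eqP ->] /=.
Qed.

Lemma count_eigenvalues (R : realType) (U : vectType R) (f : 'End(U)) (a : R) :
  count_mem a (eigenvalues f) = \dim (leigenspace f a).
Proof.
set A := mxof (vbasis {:U}) (vbasis {:U}) f.
have cp0 : char_poly A != 0 by exact/monic_neq0/char_poly_monic.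
rewrite /eigenvalues -/A count_flatten -map_comp.
set s := rootsR _; pose d b := \dim (leigenspace f b).
have s_uniq : uniq s by exact: uniq_roots.
have -> : sumn [seq (count_mem a \o (fun b => nseq (d b) b)) b | b <- s]
        = if a \in s then d a else 0%N.
  elim: s s_uniq => //= b s IHs /andP[bs us].
  rewrite IHs // count_nseq /= inE eq_sym.
  have [->|ab] /= := eqVneq a b; last by rewrite mul0n.
  by rewrite (negPf bs) mul1n addn0.
case: ifPn => // a_notin.
suff : leigenspace f a = 0%VS by move=> ->; rewrite dimv0.
apply/eqP; apply: contraNT a_notin.
rewrite (leigenspaceE (vbasisP _)) (vsof_eq0 (vbasisP _)) => Aa.
by rewrite -roots_on_rootsR // in_itv /= -eigenvalue_root_char.
Qed.

(* Main.v *)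
(* Write c = rho V_Omega.  Because the weights between B and Omega have the
   product form, -Laplacian is nearly block diagonal: functions on B with mean
   zero, extended by 0, are eigenfunctions for c; constants are eigenfunctions
   for 0; and mean-zero eigenfunctions of the induced graph on Omega with
   eigenvalue nu, extended by 0, are eigenfunctions for nu + rho V_B.  The only
   other eigenvalue, rho (V_B + V_Omega), exceeds c.  The harmonic extension of f
   is the constant mean of f on Omega, so that the Steklov spectrum is 0, c, ...,
   c.  Hence both spectra agree up to |B| exactly when no nu + rho V_B is below
   c, that is when rho (V_Omega - V_B) <= mu_2(Omega). *)

From HB Require Import structures.
Require Import Defs.
From mathcomp Require Import all_boot all_order all_algebra.
From mathcomp Require Import complex ring lra.
From mathcomp Require Import boolp classical_sets reals constructive_ereal.

Set Implicit Arguments.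
Unset Strict Implicit.
Unset Printing Implicit Defensive.
Import Order.TTheory GRing.Theory Num.Theory.
Import passmx.
Local Open Scope ring_scope.

(** * Linear algebra and sorted spectra *)

(* The roots of p in R[i] are permuted by conjugation, so pairing each root
   with its conjugate accounts for p twice. *)
Lemma monic_sqr_prod_quadratic (R : rcfType) (p : {poly R}) : p \is monic ->
  exists zs : seq (R * R),
    p * p = \prod_(z <- zs) (('X - z.1%:P) ^+ 2 + (z.2 ^+ 2)%:P).
Proof.
move=> p_monic; pose toC := real_complex R.
have [rs Dp] := closed_field_poly_normal (map_poly toC p).
have lead1 : lead_coef (map_poly toC p) = 1.
  by rewrite lead_coef_map (monicP p_monic) rmorph1.
rewrite lead1 scale1r in Dp.
have Dp_conj : map_poly toC p = \prod_(z <- rs) ('X - (z^*)%C%:P).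
  rewrite -[LHS](_ : map_poly conjc (map_poly toC p) = _); last first.
    by rewrite -map_poly_comp; apply: eq_map_poly => x; exact: conjc_real.
  rewrite Dp rmorph_prod; apply: eq_bigr => z _.
  by rewrite /= rmorphB /= map_polyX map_polyC.
exists [seq (complex.Re z, complex.Im z) | z <- rs].
apply: (map_poly_inj toC); rewrite rmorphM /= {1}Dp Dp_conj rmorph_prod /=.
rewrite -big_split big_map /=; apply: eq_bigr => -[a b] _ /=.
rewrite rmorphD rmorphXn rmorphB /= map_polyX !map_polyC /=.
(* Written as minus the square of the imaginary number ib, [b ^+ 2] turns the claim into the
   factorization of a difference of two squares. *)
have -> : (b ^+ 2)%:C%C = - (Complex 0 b) ^+ 2.
  by apply/eqP; rewrite eq_complex; apply/andP; split; apply/eqP => /=; ring.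
have -> : Complex a b = a%:C%C + Complex 0 b.
  by apply/eqP; rewrite eq_complex /= addr0 add0r !eqxx.
have -> : Complex a (- b) = a%:C%C - Complex 0 b.
  by apply/eqP; rewrite eq_complex /= subr0 add0r !eqxx.
rewrite !(rmorphD, rmorphN, rmorphXn) /=; ring.
Qed.

(* By Cayley-Hamilton some product of operators (f - a)^2 + b^2 kills a nonzero
   vector of P, hence one factor does; self-adjointness turns
   ((f - a)^2 + b^2) v = 0 into |(f - a) v|^2 + b^2 |v|^2 = 0. *)
Lemma selfadjoint_eigenvector (R : rcfType) (U : vectType R)
    (dot : U -> U -> R) (f : 'End(U)) (P : {vspace U}) :
    (forall a u v w, dot (a *: u + v) w = a * dot u w + dot v w) ->
    (forall u v, dot u v = dot v u) ->
    (forall u, u != 0 -> 0 < dot u u) ->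
    (forall u v, dot (f u) v = dot u (f v)) ->
    {in P, forall u, f u \in P} -> P != 0%VS ->
  exists a, exists2 v, v \in P & (v != 0) /\ f v = a *: v.
Proof.
move=> dotDl dotC dot_gt0 f_adj fP P_neq0.
have [n [e e_basis]] : exists n (e : n.+1.-tuple U), basis_of {:U} e.
  have dim_gt0 : (0 < \dim {:U})%N.
    rewrite lt0n dimv_eq0; apply: contraNneq P_neq0 => U0.
    by rewrite -subv0 -U0 subvf.
  move: (vbasis {:U}) (vbasisP {:U}); rewrite -(prednK dim_gt0) => e e_basis.
  by exists (\dim {:U}).-1, e.
pose rV (v : U) : 'rV[R]_n.+1 := \row_j coord e j v.
pose A : 'M[R]_n.+1 := \matrix_(i, j) coord e j (f e`_i).
have rV_lin a u v : rV (a *: u + v) = a *: rV u + rV v.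
  by apply/rowP => j; rewrite !mxE linearP.
have rV_f v : rV (f v) = rV v *m A.
  apply/rowP => j; rewrite !mxE {1}(coord_basis e_basis (memvf v)) !linear_sum.
  by apply: eq_bigr => i _; rewrite !mxE !linearZ.
have rV_eq0 v : rV v = 0 -> v = 0.
  move=> v0; rewrite (coord_basis e_basis (memvf v)) big1 // => i _.
  by have /rowP/(_ i) := v0; rewrite !mxE => ->; rewrite scale0r.
pose q (z : R * R) : {poly R} := ('X - z.1%:P) ^+ 2 + (z.2 ^+ 2)%:P.
have [zs Dzs] := monic_sqr_prod_quadratic (char_poly_monic A).
have zsA : horner_mx A (\prod_(z <- zs) q z) = 0.
  by rewrite -Dzs rmorphM /= Cayley_Hamilton mul0r.
(* The starting vector is arbitrary so that the induction on the factors can pass from [v] to its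
   image [w] under the first factor when [w] is nonzero. *)
suff step (v : U) : v \in P -> v != 0 ->
    rV v *m horner_mx A (\prod_(z <- zs) q z) = 0 ->
    exists a, exists2 v, v \in P & (v != 0) /\ f v = a *: v.
  by apply: (step (vpick P)); rewrite ?memv_pick ?vpick0 // zsA mulmx0.
elim: zs {Dzs zsA} v => [|z zs IHzs] v vP v_neq0.
  rewrite big_nil rmorph1 mulmx1 => /rV_eq0 v0.
  by rewrite v0 eqxx in v_neq0.
pose g u := f u - z.1 *: u.
have gP u : u \in P -> g u \in P by move=> uP; rewrite rpredB ?rpredZ ?fP.
pose w := g (g v) + z.2 ^+ 2 *: v.
have gA u : rV (g u) = rV u *m horner_mx A ('X - z.1%:P).
  rewrite rmorphB /= horner_mx_X horner_mx_C mulmxBr mul_mx_scalar.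
  by rewrite /g addrC -scaleNr rV_lin rV_f scaleNr addrC.
have wA : rV w = rV v *m horner_mx A (q z).
  rewrite /w addrC rV_lin !gA [horner_mx A (q z)]rmorphD /=.
  rewrite (horner_mx_C A (_ ^+ 2)) [horner_mx A (_ ^+ 2)]rmorphXn.
  by rewrite mulmxDr mul_mx_scalar expr2 mulmxA addrC.
rewrite big_cons rmorphM /= mulmxA -wA; have [w0 _|w_neq0] := eqVneq w 0; last first.
  by apply: IHzs; rewrite // rpredD ?rpredZ ?gP.
have g_adj u v' : dot (g u) v' = dot u (g v').
  rewrite /g ![_ - _]addrC -!scaleNr dotDl f_adj [RHS]dotC dotDl [dot v' u]dotC.
  by rewrite [dot (f v') u]dotC.
exists z.1, v => //; split=> //; apply/eqP; rewrite -subr_eq0 -/(g v).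
apply: contraT => /dot_gt0; rewrite g_adj => gv_gt0.
have dot0 u : dot 0 u = 0.
  have := dotDl 1 0 0 u; rewrite scaler0 addr0 mul1r => /eqP.
  by rewrite -subr_eq0 opprD addNKr oppr_eq0 => /eqP.
have : dot w v = 0 by rewrite w0 dot0.
rewrite /w addrC dotDl [dot (g (g v)) v]dotC => /eqP.
by rewrite gt_eqF // ltr_wpDl // mulr_ge0 ?sqr_ge0 // ltW ?dot_gt0.
Qed.

(** [linfun] of a bare function is the linear map with the same values on a basis; linearity makes
    the two agree everywhere. *)
Lemma linfunE (F : fieldType) (U W : vectType F) (f : U -> W) :
  linear f -> linfun f =1 f.
Proof.
move=> f_lin u.
pose m := GRing.isLinear.Build F U W *:%R f f_lin.
pose g : {linear U -> W} := HB.pack f m.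
exact: (lfunE g).
Qed.

Lemma mem_leigenspace (F : fieldType) (U : vectType F) (f : 'End(U)) a u :
  (u \in leigenspace f a) = (f u == a *: u).
Proof.
by rewrite memv_ker add_lfunE opp_lfunE scale_lfunE id_lfunE subr_eq0.
Qed.

Lemma mem_eigenvalues (R : realType) (U : vectType R) (f : 'End(U)) a :
  a \in eigenvalues f <-> exists2 u, u != 0 & f u = a *: u.
Proof.
rewrite -has_pred1 has_count count_eigenvalues lt0n dimv_eq0; split.
  move=> ev_neq0; exists (vpick (leigenspace f a)); first by rewrite vpick0.
  by apply/eqP; rewrite -mem_leigenspace memv_pick.
move=> [u u_neq0 fu]; apply: contraNneq u_neq0 => ev0.
by rewrite -memv0 -ev0 mem_leigenspace fu.
Qed.

(** In a sorted list bounded below by [c], the copies of [c] form an initial segment. *)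
Lemma sorted_ge_nth (R : realType) (c : R) (s : seq R) i :
    sorted <=%R s -> all (>= c) s -> (i < count_mem c s)%N ->
  nth 0 s i = c.
Proof.
elim: s i => // a s IHs i as_sorted /= /andP[ca cs].
have [-> | ac] := eqVneq a c.
  by case: i => // i; apply: IHs => //; exact: path_sorted as_sorted.
have lt_ca : c < a by rewrite lt_def ac.
suff -> : count_mem c s = 0%N by [].
apply/count_memPn/negP => c_s.
have := allP (order_path_min le_trans as_sorted) _ c_s.
by rewrite leNgt lt_ca.
Qed.

(** Both spectra are read off with this: the simple 0 comes first, and the gap makes the copies of
    [c] follow at once. Positions count from 0, so [n] copies of [c] reach position [n]. *)
Lemma nth_sorted_gap (R : realType) (c : R) (s : seq R) n i :
    0 < c -> sorted <=%R s -> (forall a, a \in s -> a = 0 \/ c <= a) ->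
    count_mem 0 s = 1%N -> (n <= count_mem c s)%N -> (i <= n)%N ->
  nth 0 s i = if i == 0%N then 0 else c.
Proof.
move=> c_gt0; case: s => // a s as_sorted s_gap.
have min_a := order_path_min le_trans as_sorted.
have s0 : all (>= 0) (a :: s).
  by apply/allP => b /s_gap[-> // | /(le_trans (ltW c_gt0))].
have [a0 | a_neq0] := eqVneq a 0; last first.
  move=> cnt; have : 0 \in a :: s by rewrite -has_pred1 has_count cnt.
  rewrite inE eq_sym (negPf a_neq0) => /(allP min_a) /= a_le0.
  by case/andP: s0 => a_ge0; rewrite eq_le a_le0 a_ge0 in a_neq0.
rewrite a0 /= eqxx (lt_eqF c_gt0) => -[/count_memPn s_no0].
case: i => // i n_le i_lt /=; apply: sorted_ge_nth (leq_trans i_lt n_le).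
  exact: path_sorted as_sorted.
apply/allP => b bs; have [b0|//] : b = 0 \/ c <= b.
  by apply: s_gap; rewrite inE bs orbT.
by rewrite -b0 bs in s_no0.
Qed.

Lemma dim_lker_ge (F : fieldType) (U W : vectType F) (f : 'Hom(U, W)) :
  (dim U <= \dim (lker f) + dim W)%N.
Proof.
rewrite -!dimvf -(limg_ker_dim f fullv) capfv leq_add2l.
exact/dimvS/subvf.
Qed.

(** The head of the list is 0. Either [a] differs from it or 0 has a second copy, so [a] lies in the
    tail, whose first entry is the smallest. *)
Lemma sorted_second_le (R : realType) (s : seq R) a :
    sorted <=%R s -> (forall b, b \in s -> 0 <= b) -> 0 \in s -> a \in s ->
    (a = 0 -> (1 < count_mem 0%R s)%N) ->
  nth 0 s 1 <= a.
Proof.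
case: s => // b t bt_sorted bt_ge0.
have min_b := order_path_min le_trans bt_sorted.
have b_le0 : 0 \in b :: t -> b <= 0.
  by rewrite inE => /orP[/eqP <- //|/(allP min_b)].
move=> /b_le0 b_le a_bt cnt0.
have b0 : b = 0 by apply: le_anti; rewrite b_le bt_ge0 ?mem_head.
have at_ : a \in t.
  move: a_bt cnt0; rewrite inE b0 /= eqxx => /orP[/eqP a0|//] /(_ a0).
  by rewrite a0 add1n ltnS -has_count has_pred1.
case: t at_ bt_sorted {b_le0 bt_ge0 min_b a_bt cnt0} => //= c t.
rewrite inE => /orP[/eqP ->|a_t] /andP[_ ct_sorted] //.
exact: (allP (order_path_min le_trans ct_sorted)).
Qed.

(** * The Laplacian of a weighted graph *)

(** The integral against the vertex measure; its kernel, the mean-zero functions, is the orthogonal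
    complement of the constants. *)
Definition vsum (R : realType) (V : finType) (G : wgraph R V)
    (u : {ffun V -> R^o}) : R^o := \sum_x vmeas G x * u x.

Definition lap_op (R : realType) (V : finType) (G : wgraph R V) :
    'End({ffun V -> R^o}) := linfun (fun u => - laplacian G u).

Definition restr (R : realType) (V : finType) (A : {set V})
    (u : {ffun V -> R^o}) : {ffun {x : V | x \in A} -> R^o} :=
  [ffun x => u (val x)].

(** The value [c] is 0 for eigenfunctions extended by zero and the mean of [f] for the harmonic
    extension. *)
Definition extend (R : realType) (V : finType) (A : {set V}) (c : R)
    (f : {ffun {x : V | x \in A} -> R^o}) : {ffun V -> R^o} :=
  [ffun x => if insub x is Some y then f y else c].

Lemma vsum_linear (R : realType) (V : finType) (G : wgraph R V) :
  linear (vsum G).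
Proof.
move=> a u v; rewrite /vsum scaler_sumr -big_split /=.
by apply: eq_bigr => x _; rewrite !ffunE /GRing.scale /=; ring.
Qed.

Lemma laplacianE (R : realType) (V : finType) (G : wgraph R V) u x :
  laplacian G u x = - normal_derivative G u x.
Proof.
rewrite ffunE /normal_derivative -mulrN -sumrN; congr (_ * _).
by apply: eq_bigr => y _; rewrite -mulNr opprB.
Qed.

Lemma normal_derivative_linear (R : realType) (V : finType) (G : wgraph R V)
    a u v x :
  normal_derivative G (a *: u + v) x =
  a * normal_derivative G u x + normal_derivative G v x.
Proof.
rewrite /normal_derivative mulrCA -mulrDr; congr (_ * _).
rewrite mulr_sumr -big_split /=.
by apply: eq_bigr => y _; rewrite !ffunE /GRing.scale /=; ring.
Qed.

Lemma lap_opE (R : realType) (V : finType) (G : wgraph R V) u x :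
  lap_op G u x = normal_derivative G u x.
Proof.
have nlE v y : (- laplacian G v) y = normal_derivative G v y.
  by rewrite ffunE laplacianE opprK.
rewrite linfunE ?nlE // => a v w; apply/ffunP => y.
by rewrite nlE normal_derivative_linear [RHS]ffunE nlE [X in _ = X + _]ffunE nlE.
Qed.

(** Green's formula: the measure cancels its reciprocal in the Laplacian, and averaging with the sum
    in which [x] and [y] are exchanged gives the symmetric form. *)
Lemma dirichlet_formE (R : realType) (V : finType) (G : wgraph R V) u v :
  \sum_x vmeas G x * (u x * lap_op G v x) =
  2^-1 * \sum_x \sum_y ewt G x y * ((u x - u y) * (v x - v y)).
Proof.
have E : \sum_x vmeas G x * (u x * lap_op G v x) =
         \sum_x \sum_y ewt G x y * (u x * (v x - v y)).
  apply: eq_bigr => x _; rewrite lap_opE /normal_derivative.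
  rewrite [u x * _]mulrCA mulVKf ?gt_eqF ?vmeas_gt0 // mulr_sumr.
  by apply: eq_bigr => y _; ring.
have E' : \sum_x vmeas G x * (u x * lap_op G v x) =
          \sum_x \sum_y ewt G x y * (u y * (v y - v x)).
  rewrite E exchange_big; apply: eq_bigr => x _; apply: eq_bigr => y _.
  by rewrite ewt_sym.
have two : (2 : R) != 0 by rewrite pnatr_eq0.
apply: (mulfI two).
rewrite mulVKf // mulr_natl mulr2n {1}E E' -big_split /=.
apply: eq_bigr => x _; rewrite -big_split /=.
by apply: eq_bigr => y _; ring.
Qed.

Lemma ewt_ge0 (R : realType) (V : finType) (G : wgraph R V) x y :
  0 <= ewt G x y.
Proof.
by case: (boolP (adj G x y)) => [/ewt_gt0/ltW // | /ewt_eq0 ->].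
Qed.

Lemma normsq_gt0 (R : realType) (V : finType) (G : wgraph R V)
    (u : {ffun V -> R^o}) :
  u != 0 -> 0 < \sum_x vmeas G x * (u x * u x).
Proof.
move=> u_neq0; have terms x : true -> 0 <= vmeas G x * (u x * u x).
  by rewrite mulr_ge0 ?sqr_ge0 // ltW ?vmeas_gt0.
rewrite lt_def sumr_ge0 // andbT; apply: contraNneq u_neq0 => /eqP.
rewrite psumr_eq0 // => /allP u0; apply/eqP/ffunP => x; rewrite ffunE.
have := u0 x (mem_index_enum x); rewrite mulf_eq0 gt_eqF ?vmeas_gt0 //=.
by rewrite mulf_eq0 orbb => /eqP.
Qed.

(** The Dirichlet energy of [u] is [a] times its squared norm. *)
Lemma lap_eigenvalue_ge0 (R : realType) (V : finType) (G : wgraph R V) u a :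
  u != 0 -> lap_op G u = a *: u -> 0 <= a.
Proof.
move=> u_neq0 Lu; rewrite -(pmulr_lge0 _ (normsq_gt0 G u_neq0)) mulr_sumr.
have -> : \sum_x a * (vmeas G x * (u x * u x)) =
          \sum_x vmeas G x * (u x * lap_op G u x).
  by apply: eq_bigr => x _; rewrite Lu ffunE /GRing.scale /=; ring.
rewrite dirichlet_formE mulr_ge0 ?invr_ge0 //.
by do 2!apply: sumr_ge0 => ? _; rewrite mulr_ge0 ?ewt_ge0 ?sqr_ge0.
Qed.

(** Green's formula against the constant 1, whose differences vanish. *)
Lemma vsum_lap (R : realType) (V : finType) (G : wgraph R V) u :
  vsum G (lap_op G u) = 0.
Proof.
transitivity (\sum_x vmeas G x * ([ffun=> 1 : R^o] x * lap_op G u x)).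
  by apply: eq_bigr => x _; rewrite ffunE mul1r.
rewrite dirichlet_formE big1 ?mulr0 // => x _; rewrite big1 // => y _.
by rewrite !ffunE subrr mul0r mulr0.
Qed.

Lemma lap_const (R : realType) (V : finType) (G : wgraph R V) (c : R) :
  lap_op G [ffun=> c] = 0.
Proof.
apply/ffunP => x; rewrite lap_opE [RHS]ffunE /normal_derivative.
rewrite big1 ?mulr0 // => y _.
by rewrite !ffunE subrr mul0r.
Qed.

Lemma dim_mean_zero (R : realType) (V : finType) (G : wgraph R V) :
  (#|V| - 1 <= \dim (lker (linfun (vsum G))))%N.
Proof.
have := dim_lker_ge (linfun (vsum G)).
have -> : dim {ffun V -> R^o} = #|V| by rewrite /dim /= muln1.
have -> : dim (R^o : vectType R) = 1%N by [].
by rewrite leq_subLR addnC.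
Qed.

Lemma mem_mean_zero (R : realType) (V : finType) (G : wgraph R V) u :
  (u \in lker (linfun (vsum G))) = (vsum G u == 0).
Proof. by rewrite memv_ker linfunE //; exact: vsum_linear. Qed.

(** The Laplacian maps into the mean-zero functions, a nonzero space when there are two vertices, so
    [selfadjoint_eigenvector] applies there. *)
Lemma mean_zero_eigenvector (R : realType) (V : finType) (G : wgraph R V) :
    (1 < #|V|)%N ->
  exists a v, [/\ v != 0, vsum G v = 0 & lap_op G v = a *: v].
Proof.
move=> V_gt1; pose P := lker (linfun (vsum G)).
have [] := @selfadjoint_eigenvector R {ffun V -> R^o}
  (fun u v => \sum_x vmeas G x * (u x * v x)) (lap_op G) P.
- move=> a u v w; rewrite mulr_sumr -big_split /=.
  by apply: eq_bigr => x _; rewrite !ffunE /GRing.scale /=; ring.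
- by move=> u v; apply: eq_bigr => x _; rewrite [u x * _]mulrC.
- exact: normsq_gt0.
- move=> u v; rewrite dirichlet_formE.
  under eq_bigr => x _ do rewrite [lap_op G u x * _]mulrC.
  rewrite dirichlet_formE; congr (_ * _).
  by do 2!apply: eq_bigr => ? _; rewrite [X in _ * X]mulrC.
- by move=> u _; rewrite mem_mean_zero vsum_lap.
- rewrite -dimv_eq0 -lt0n (leq_trans _ (dim_mean_zero G)) //.
  by rewrite subn_gt0.
- by move=> a [v vP [v_neq0 Lv]]; exists a, v; split=> //; apply/eqP; rewrite -mem_mean_zero.
Qed.

Lemma const1_neq0 (R : realType) (V : finType) (x : V) :
  [ffun=> 1] != 0 :> {ffun V -> R^o}.
Proof. by apply/eqP => /ffunP/(_ x)/eqP; rewrite !ffunE oner_eq0. Qed.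

Lemma total_meas_gt0 (R : realType) (V : finType) (G : wgraph R V) (x : V) :
  0 < vsum G [ffun=> 1].
Proof.
rewrite /vsum (bigD1 x) //= ffunE mulr1 ltr_pwDl ?vmeas_gt0 // sumr_ge0 // => y _.
by rewrite ffunE mulr1 ltW ?vmeas_gt0.
Qed.

Lemma zero_lap_eigenvalue (R : realType) (V : finType) (G : wgraph R V) (x : V) :
  0 \in eigenvalues (lap_op G).
Proof.
apply/mem_eigenvalues; exists [ffun=> 1]; first exact: const1_neq0 x.
by rewrite lap_const scale0r.
Qed.

Lemma lap_eigenvalues_ge0 (R : realType) (V : finType) (G : wgraph R V) a :
  a \in eigenvalues (lap_op G) -> 0 <= a.
Proof. by move/mem_eigenvalues => [u /lap_eigenvalue_ge0]; apply. Qed.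

(** For [a = 0] the constants and [v] are independent because [v] has mean zero, so 0 is a double
    eigenvalue; otherwise [a] comes after 0 in the list. *)
Lemma laplace_eigval2_le (R : realType) (V : finType) (G : wgraph R V) v a :
    v != 0 -> vsum G v = 0 -> lap_op G v = a *: v ->
  laplace_eigval G 2 <= a.
Proof.
move=> v_neq0 v_sum Lv; have [x _] : exists x, v x != 0.
  apply/existsP; rewrite -negb_forall; apply: contraNN v_neq0 => /forallP v0.
  by apply/eqP/ffunP => x; rewrite ffunE; apply/eqP.
apply: sorted_second_le (eigenvalues_sorted _) _ (zero_lap_eigenvalue G x) _ _.
- exact: lap_eigenvalues_ge0.
- by apply/mem_eigenvalues; exists v.
move=> a0; rewrite count_eigenvalues -/(lap_op G).
pose one : {ffun V -> R^o} := [ffun=> 1].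
have one_neq0 : one != 0 := const1_neq0 R x.
have sub : (<[one]> + <[v]> <= leigenspace (lap_op G) 0)%VS.
  by rewrite subv_add -!memvE !mem_leigenspace lap_const Lv a0 !scale0r !eqxx.
apply: leq_trans (dimvS sub); rewrite dimv_disjoint_sum ?dim_vline ?one_neq0 ?v_neq0 //.
apply/eqP; rewrite -subv0; apply/subvP => u; rewrite memv_cap.
case/andP => /vlineP[b ->] /vlineP[c] /(congr1 (vsum G)).
have lin := linfunE (vsum_linear G).
rewrite -!lin !linearZ /= !lin v_sum scaler0 => /eqP.
rewrite mulf_eq0 (gt_eqF (total_meas_gt0 G x)) orbF => /eqP ->.
by rewrite scale0r mem0v.
Qed.

(** For a nonzero value, any eigenfunction has mean zero by [vsum_lap]. For the value 0, a mean-zero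
    kernel element comes from [mean_zero_eigenvector] or from a nonconstant kernel element. *)
Lemma laplace_eigval2_eigenvector (R : realType) (V : finType)
    (G : wgraph R V) : (1 < #|V|)%N ->
  exists v, [/\ v != 0, vsum G v = 0
              & lap_op G v = laplace_eigval G 2 *: v].
Proof.
move=> V_gt1; have [a [v [v_neq0 v_sum Lv]]] := mean_zero_eigenvector G V_gt1.
have [x _] : exists x : V, x \in V by apply/card_gt0P; exact: ltnW.
pose s := eigenvalues (lap_op G).
have mu2E : laplace_eigval G 2 = nth 0 s 1 by [].
have lin := linfunE (vsum_linear G).
have [mu0 | mu_neq0] := eqVneq (laplace_eigval G 2) 0; last first.
  (* Past the end of the list [nth] would return its default 0. *)
  have [size_s | size_s] := ltnP 1 (size s); last first.
    by rewrite mu2E nth_default ?eqxx in mu_neq0.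
  have /mem_eigenvalues[u u_neq0 Lu] : laplace_eigval G 2 \in s.
    by rewrite mu2E mem_nth.
  exists u; split=> //; have := vsum_lap G u.
  rewrite Lu -lin linearZ /= lin => /eqP; rewrite mulf_eq0.
  by rewrite (negPf mu_neq0) => /eqP.
have [a0 | a_neq0] := eqVneq a 0; first by rewrite a0 in Lv; exists v; rewrite mu0.
(* The list s contains 0 and a, so its second entry is not a default value:
   being 0, it shows that the eigenvalue 0 is not simple. *)
have cnt : (1 < count_mem 0%R s)%N.
  have as_ : a \in s by apply/mem_eigenvalues; exists v.
  have s0 : 0 \in s := zero_lap_eigenvalue G x.
  move: (eigenvalues_sorted (lap_op G)) (@lap_eigenvalues_ge0 _ _ G) mu0 as_ s0.
  rewrite mu2E -/s; case: s {mu2E} => [|b [|c t]] //=.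
    by move=> _ _ _; rewrite !inE => /eqP <-; rewrite eq_sym (negPf a_neq0).
  move=> /andP[bc _] ge0 c0 _ _; suff -> : b = 0 by rewrite c0 !eqxx.
  by apply: le_anti; rewrite -{1}c0 bc ge0 ?mem_head.
pose one : {ffun V -> R^o} := [ffun=> 1].
have /subvPn[u uE u_notin] : ~~ (leigenspace (lap_op G) 0 <= <[one]>)%VS.
  apply: contraL cnt => /dimvS; rewrite dim_vline (const1_neq0 R x).
  by rewrite count_eigenvalues -leqNgt.
have mE := total_meas_gt0 G x; rewrite -/one in mE.
(* Subtracting the mean stays in the kernel, and the result is nonzero because [u] is not
   constant. *)
exists (u - (vsum G u / vsum G one) *: one); split.
- apply: contraNneq u_notin => /eqP; rewrite subr_eq0 => /eqP ->.
  exact/memvZ/memv_line.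
- by rewrite -lin linearB linearZ /= !lin /GRing.scale /= divfK ?subrr ?gt_eqF.
rewrite mu0 scale0r linearB linearZ /= lap_const scaler0 subr0.
by move: uE; rewrite mem_leigenspace scale0r => /eqP.
Qed.

(** * Boundary weights of product form *)

Definition meas_of (R : realType) (V : finType) (G : wgraph R V)
    (A : {set V}) : R := \sum_(x in A) vmeas G x.

Definition uniform_boundary (R : realType) (V : finType) (G : wgraph R V)
    (B : {set V}) (rho : R) : Prop :=
  forall x y, x \in B -> y \in ~: B ->
    ewt G x y = rho * vmeas G x * vmeas G y.

Lemma vsum_restr (R : realType) (V : finType) (G : wgraph R V) (A : {set V})
    (u : {ffun V -> R^o}) :
  vsum (induced G A) (restr A u) = \sum_(x in A) vmeas G x * u x.
Proof. by rewrite big_sub; apply: eq_bigr => x _; rewrite ffunE. Qed.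

Lemma extend_in (R : realType) (V : finType) (A : {set V}) (c : R)
    (f : {ffun {x : V | x \in A} -> R^o}) x : extend c f (val x) = f x.
Proof. by rewrite ffunE valK. Qed.

Lemma extend_out (R : realType) (V : finType) (A : {set V}) (c : R)
    (f : {ffun {x : V | x \in A} -> R^o}) x : x \notin A -> extend c f x = c.
Proof. by move=> xA; rewrite ffunE insubN. Qed.

Lemma restr_extend (R : realType) (V : finType) (A : {set V}) (c : R)
    (f : {ffun {x : V | x \in A} -> R^o}) : restr A (extend c f) = f.
Proof. by apply/ffunP => x; rewrite ffunE extend_in. Qed.

Lemma restrC_extend (R : realType) (V : finType) (A : {set V}) (c : R)
    (f : {ffun {x : V | x \in A} -> R^o}) :
  restr (~: A) (extend c f) = [ffun=> c].
Proof.
apply/ffunP => x; rewrite !ffunE insubN //.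
by have := valP x; rewrite inE.
Qed.

Lemma vsum_const (R : realType) (V : finType) (G : wgraph R V) (A : {set V})
    (c : R) :
  vsum (induced G A) [ffun=> c] = c * meas_of G A.
Proof.
rewrite /meas_of mulr_sumr big_sub; apply: eq_bigr => x _.
by rewrite ffunE mulrC.
Qed.

Lemma meas_of_gt0 (R : realType) (V : finType) (G : wgraph R V) (A : {set V}) x :
  x \in A -> 0 < meas_of G A.
Proof.
move=> xA; rewrite /meas_of (bigD1 x) //= ltr_pwDl ?vmeas_gt0 // sumr_ge0 // => y _.
by rewrite ltW ?vmeas_gt0.
Qed.

Lemma boundary_interior (R : realType) (V : finType) (G : wgraph R V)
    (B : {set V}) :
  vertex_boundary G B -> (0 < #|B|)%N -> exists y, y \in ~: B.
Proof.
by move=> [_ adjB] /card_gt0P[x /adjB[y yB _]]; exists y.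
Qed.

(** All neighbours of a boundary vertex are interior, and the product weights let their values enter
    only through their integral. *)
Lemma normal_derivative_boundary (R : realType) (V : finType)
    (G : wgraph R V) (B : {set V}) (rho : R) u x :
    vertex_boundary G B -> uniform_boundary G B rho -> x \in B ->
  normal_derivative G u x =
    rho * (meas_of G (~: B) * u x - vsum (induced G (~: B)) (restr (~: B) u)).
Proof.
move=> [noadj _] w_rho xB; rewrite /normal_derivative (bigID (mem B)) /= big1; last first.
  by move=> y yB; rewrite ewt_eq0 ?mulr0 // noadj.
rewrite add0r vsum_restr mulr_suml -sumrB !mulr_sumr.
rewrite (eq_bigl (mem (~: B))) => [|y]; last by rewrite !inE.
apply: eq_bigr => y yB; rewrite w_rho //.
by field; rewrite gt_eqF ?vmeas_gt0.
Qed.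

(** Interior neighbours contribute the Laplacian of the induced graph; boundary values enter only
    through their integral. *)
Lemma normal_derivative_interior (R : realType) (V : finType)
    (G : wgraph R V) (B : {set V}) (rho : R) u (x : {x : V | x \in ~: B}) :
    uniform_boundary G B rho ->
  normal_derivative G u (val x) =
    lap_op (induced G (~: B)) (restr (~: B) u) x +
    rho * (meas_of G B * u (val x) - vsum (induced G B) (restr B u)).
Proof.
move=> w_rho; rewrite lap_opE /normal_derivative (bigID (mem B)) /= mulrDr addrC.
congr (_ + _).
  congr (_ * _); rewrite (eq_bigl (mem (~: B))) => [|y]; last by rewrite !inE.
  by rewrite big_sub; apply: eq_bigr => y _; rewrite !ffunE.
rewrite vsum_restr mulr_suml -sumrB !mulr_sumr.
apply: eq_bigr => y yB; rewrite ewt_sym w_rho ?(valP x) //.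
by field; rewrite gt_eqF ?vmeas_gt0.
Qed.

(* On Omega, such a u is an eigenfunction of the Laplacian of the induced graph
   for the negative number - rho V_B. *)
Lemma harmonic_eq0 (R : realType) (V : finType) (G : wgraph R V)
    (B : {set V}) (rho : R) (u : {ffun V -> R^o}) :
    uniform_boundary G B rho -> 0 < rho -> (0 < #|B|)%N ->
    (forall x, x \in B -> u x = 0) ->
    (forall x, x \in ~: B -> normal_derivative G u x = 0) ->
  u = 0.
Proof.
move=> w_rho rho_gt0 /card_gt0P[b bB] uB0 uO.
have rB0 : vsum (induced G B) (restr B u) = 0.
  by rewrite vsum_restr big1 // => x /uB0 ->; rewrite mulr0.
have res0 : restr (~: B) u = 0.
  apply: contraTeq (mulr_gt0 rho_gt0 (meas_of_gt0 G bB)) => res_neq0.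
  rewrite -leNgt -oppr_ge0.
  apply: (@lap_eigenvalue_ge0 _ _ (induced G (~: B)) _ _ res_neq0).
  apply/ffunP => x; have := uO _ (valP x).
  rewrite (normal_derivative_interior _ _ w_rho) rB0 subr0 => /eqP.
  rewrite addr_eq0 => /eqP ->; rewrite !ffunE /GRing.scale /=; ring.
apply/ffunP => x; rewrite ffunE; have [/uB0 // | xB] := boolP (x \in B).
have xO : x \in ~: B by rewrite inE.
by have /ffunP/(_ (exist _ x xO)) := res0; rewrite !ffunE.
Qed.

(** * Harmonic extension and the Steklov spectrum *)

Lemma harmonic_extensionE (R : realType) (V : finType) (G : wgraph R V)
    (B : {set V}) (rho : R) f :
    uniform_boundary G B rho -> 0 < rho -> (0 < #|B|)%N ->
  harmonic_extension G f = extend (vsum (induced G B) f / meas_of G B) f.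
Proof.
move=> w_rho rho_gt0 B_gt0; have [b bB] := card_gt0P B_gt0.
have VB_neq0 : meas_of G B != 0 by rewrite gt_eqF ?(meas_of_gt0 G bB).
(* A constant on the interior kills the induced Laplacian; the remaining term vanishes exactly when
   that constant is the mean of [f]. *)
have harm : is_harmonic_extension G f
              (extend (vsum (induced G B) f / meas_of G B) f).
  split=> [x|x xO]; first by rewrite extend_in.
  rewrite laplacianE (normal_derivative_interior _ (exist _ x xO) w_rho) /=.
  rewrite restr_extend restrC_extend lap_const extend_out; last by move: xO; rewrite inE.
  by rewrite ffunE add0r [meas_of G B * _]mulrC divfK // subrr mulr0 oppr0.
(* Two extensions differ by a function that vanishes on [B] and is harmonic inside, to which
   [harmonic_eq0] applies. *)
apply: xget_unique => // v [vB vO].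
apply/eqP; rewrite -subr_eq0; apply/eqP.
apply: (harmonic_eq0 w_rho rho_gt0 B_gt0) => x xB.
  have [/(_ (exist _ x xB)) /= extB _] := harm.
  have /= vx := vB (exist _ x xB).
  by rewrite ffunE [X in _ + X]ffunE extB vx subrr.
rewrite addrC -scaleN1r normal_derivative_linear.
have [_ /(_ x xB)] := harm; rewrite laplacianE => /eqP; rewrite oppr_eq0 => /eqP ->.
by have /eqP := vO x xB; rewrite laplacianE oppr_eq0 => /eqP ->; rewrite mulr0 addr0.
Qed.

(** The Dirichlet-to-Neumann map is a multiple of the projection onto mean-zero functions, since the
    extension equals the mean of [f] at every interior vertex. *)
Lemma dirichlet_to_neumannE (R : realType) (V : finType) (G : wgraph R V)
    (B : {set V}) (rho : R) f x :
    vertex_boundary G B -> uniform_boundary G B rho -> 0 < rho ->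
    (0 < #|B|)%N ->
  linfun (@dirichlet_to_neumann R V G B) f x =
    rho * meas_of G (~: B) * (f x - vsum (induced G B) f / meas_of G B).
Proof.
move=> bdry w_rho rho_gt0 B_gt0.
have dtnE g y : dirichlet_to_neumann G g y =
    rho * meas_of G (~: B) * (g y - vsum (induced G B) g / meas_of G B).
  rewrite ffunE (normal_derivative_boundary _ bdry w_rho (valP y)).
  rewrite (harmonic_extensionE _ w_rho) // restrC_extend vsum_const extend_in.
  by ring.
rewrite linfunE ?dtnE // => a u v; apply/ffunP => y.
rewrite dtnE [RHS]ffunE dtnE [X in _ = X + _]ffunE dtnE vsum_linear !ffunE.
by rewrite /GRing.scale /=; ring.
Qed.

Lemma const_line (R : realType) (V : finType) (c : R) :
  [ffun=> c] = c *: [ffun=> 1] :> {ffun V -> R^o}.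
Proof. by apply/ffunP => x; rewrite !ffunE /GRing.scale /= mulr1. Qed.

Lemma dim_const (R : realType) (V : finType) (x : V) (U : {vspace {ffun V -> R^o}}) :
    (forall u, u \in U <-> exists c : R, u = [ffun=> c]) ->
  \dim U = 1%N.
Proof.
move=> UE; pose one : {ffun V -> R^o} := [ffun=> 1].
suff -> : U = <[one]>%VS by rewrite dim_vline (const1_neq0 R x).
apply/vspaceP => u; apply/idP/vlineP => [/UE[c ->]|[c ->]].
  by exists c; rewrite const_line.
by apply/UE; exists c; rewrite const_line.
Qed.

Lemma steklov_eigval_uniform (R : realType) (V : finType) (G : wgraph R V)
    (B : {set V}) (rho : R) i :
    vertex_boundary G B -> uniform_boundary G B rho -> 0 < rho ->
    (1 <= i <= #|B|)%N ->
  steklov_eigval G B i = if i == 1%N then 0 else rho * meas_of G (~: B).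
Proof.
move=> bdry w_rho rho_gt0 /andP[i_gt0 i_le].
have B_gt0 : (0 < #|B|)%N by exact: leq_trans i_le.
have [b bB] := card_gt0P B_gt0; have [y yO] := boundary_interior bdry B_gt0.
have c_gt0 : 0 < rho * meas_of G (~: B) by rewrite mulr_gt0 ?(meas_of_gt0 G yO).
have VB_gt0 := meas_of_gt0 G bB.
have dtnE f x := dirichlet_to_neumannE f x bdry w_rho rho_gt0 B_gt0.
rewrite /steklov_eigval /eigval (nth_sorted_gap (n := (#|B| - 1)%N) c_gt0) //.
- by case: i i_gt0 {i_le} => [|[|i]].
- exact: eigenvalues_sorted.
- move=> a /mem_eigenvalues[f f_neq0 Lf].
  have lin := linfunE (vsum_linear (induced G B)).
  (* The image has mean zero, so a nonzero [a] forces [f] to have mean zero, and such an [f] is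
     scaled by [rho * meas_of G (~: B)]. *)
  have : vsum (induced G B) (a *: f) = 0.
    pose S : R := vsum (induced G B) f / meas_of G B.
    rewrite -Lf (_ : linfun _ f = (rho * meas_of G (~: B)) *: (f - [ffun=> S])).
      rewrite -lin linearZ linearB /= !lin vsum_const /S divfK ?gt_eqF //.
      by rewrite subrr scaler0.
    by apply/ffunP => x; rewrite dtnE !ffunE.
  rewrite -lin linearZ /= lin => /eqP; rewrite mulf_eq0 => /orP[/eqP|/eqP f0].
    by left.
  right; suff -> : a = rho * meas_of G (~: B) by [].
  apply/eqP; rewrite -subr_eq0; apply: contraTT f_neq0 => ac_neq0.
  rewrite negbK; apply/eqP/ffunP => x; rewrite ffunE; apply/eqP.
  rewrite -(mulrI_eq0 _ (mulfI ac_neq0)) mulrBl subr_eq0.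
  have /ffunP/(_ x) := Lf; rewrite dtnE f0 mul0r subr0 ffunE => ->.
  by [].
- rewrite count_eigenvalues; apply: (dim_const (exist _ b bB : {x | x \in B})) => f.
  rewrite mem_leigenspace scale0r; split=> [/eqP/ffunP Lf0 | [c ->]].
    exists (vsum (induced G B) f / meas_of G B); apply/ffunP => x; rewrite ffunE.
    have /eqP := Lf0 x; rewrite dtnE ffunE mulf_eq0 gt_eqF //= subr_eq0.
    by move=> /eqP.
  apply/eqP/ffunP => x; rewrite dtnE !ffunE vsum_const mulfK ?gt_eqF //.
  by rewrite subrr mulr0.
- rewrite count_eigenvalues.
  have := dim_mean_zero (induced G B); rewrite card_sig.
  move=> /leq_trans; apply; apply/dimvS/subvP => f; rewrite mem_mean_zero => /eqP f0.
  rewrite mem_leigenspace; apply/eqP/ffunP => x.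
  by rewrite dtnE f0 mul0r subr0 [RHS]ffunE.
- by case: i i_gt0 i_le => // i _ i_le; rewrite leq_subRL ?add1n.
Qed.

(** * Laplacian eigenfunctions of the whole graph *)

Lemma lap_extend0 (R : realType) (V : finType) (G : wgraph R V)
    (B : {set V}) (rho a : R) v :
    vertex_boundary G B -> uniform_boundary G B rho ->
    vsum (induced G (~: B)) v = 0 -> lap_op (induced G (~: B)) v = a *: v ->
  lap_op G (extend 0 v) = (a + rho * meas_of G B) *: extend 0 v.
Proof.
move=> bdry w_rho v_sum Lv; apply/ffunP => x; rewrite lap_opE [RHS]ffunE.
have vB0 z : z \in B -> extend 0 v z = 0.
  by move=> zB; rewrite extend_out // inE zB.
(* On [B] both sides vanish because [v] has mean zero; inside, the zero boundary values add
   [rho * meas_of G B] to the eigenvalue. *)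
have [xB|xB] := boolP (x \in B).
  rewrite (normal_derivative_boundary _ bdry w_rho xB) restr_extend v_sum vB0 //.
  by rewrite scaler0 mulr0 subr0 mulr0.
have xO : x \in ~: B by rewrite inE.
rewrite (normal_derivative_interior _ (exist _ x xO) w_rho) restr_extend Lv.
rewrite vsum_restr big1 => [|z /vB0 ->]; last by rewrite mulr0.
by rewrite -[x]/(val (exist _ x xO)) extend_in ffunE subr0 mulrA scalerDl.
Qed.

Lemma vsum_split (R : realType) (V : finType) (G : wgraph R V) (B : {set V}) u :
  vsum G u = vsum (induced G B) (restr B u)
             + vsum (induced G (~: B)) (restr (~: B) u).
Proof.
rewrite !vsum_restr /vsum (bigID (mem B)) /=; congr (_ + _).
by apply: eq_bigl => x; rewrite inE.
Qed.

(** The bound on [a] forces first the integral of [u] over [B] and then [u] itself on [B] to vanish,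
    which leaves the equation of the induced graph. *)
Lemma small_eigenvector_restr (R : realType) (V : finType) (G : wgraph R V)
    (B : {set V}) (rho a : R) u :
    vertex_boundary G B -> uniform_boundary G B rho -> 0 < rho ->
    (0 < #|B|)%N ->
    u != 0 -> lap_op G u = a *: u -> a != 0 -> a < rho * meas_of G (~: B) ->
  exists v, [/\ v != 0, vsum (induced G (~: B)) v = 0
    & lap_op (induced G (~: B)) v = (a - rho * meas_of G B) *: v].
Proof.
move=> bdry w_rho rho_gt0 B_gt0 u_neq0 Lu a_neq0 a_lt.
have [b bB] := card_gt0P B_gt0; have [y yO] := boundary_interior bdry B_gt0.
have VB_gt0 := meas_of_gt0 G bB; have VO_gt0 := meas_of_gt0 G yO.
set O := ~: B in a_lt VO_gt0 *.
pose SB : R := vsum (induced G B) (restr B u).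
pose SO : R := vsum (induced G O) (restr O u).
have S0 : SB + SO = 0.
  have := vsum_lap G u; have lin := linfunE (vsum_linear G).
  rewrite Lu -lin linearZ /= lin => /eqP; rewrite mulf_eq0 (negPf a_neq0) /=.
  by move=> /eqP; rewrite (vsum_split G B).
have uB x : x \in B -> a * u x = rho * (meas_of G O * u x - SO).
  move=> xB; rewrite -(normal_derivative_boundary _ bdry w_rho xB) -lap_opE Lu.
  by rewrite ffunE.
(* The eigenvalue equation integrated over [B]. *)
have aSB : a * SB = rho * (meas_of G O * SB - meas_of G B * SO).
  transitivity (\sum_(x in B) vmeas G x * (rho * (meas_of G O * u x - SO))).
    rewrite /SB vsum_restr mulr_sumr; apply: eq_bigr => x xB.
    by rewrite mulrCA uB.
  rewrite /SB vsum_restr [meas_of G O * _]mulr_sumr [meas_of G B * _]mulr_suml.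
  by rewrite -sumrB mulr_sumr; apply: eq_bigr => x _; ring.
have SB0 : SB = 0.
  (* Substituting [SO = - SB] makes the factor positive, since [a < rho * meas_of G O]. *)
  have /eqP : (rho * meas_of G O - a + rho * meas_of G B) * SB = 0.
    move: aSB; have -> : SO = - SB by apply/eqP; rewrite -addr_eq0 addrC S0.
    by move=> e; rewrite !mulrDl mulNr e; ring.
  rewrite mulf_eq0 gt_eqF /=; first by move=> /eqP.
  by have := mulr_gt0 rho_gt0 VB_gt0; lra.
have SO0 : SO = 0 by move: S0; rewrite SB0 add0r.
have uB0 x : x \in B -> u x = 0.
  move=> /uB; rewrite SO0 subr0 mulrA => /eqP.
  by rewrite -subr_eq0 -mulrBl mulf_eq0 subr_eq0 (lt_eqF a_lt) => /eqP.
exists (restr O u); split=> //.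
  apply: contraNneq u_neq0 => res0; apply/eqP/ffunP => x; rewrite ffunE.
  have [/uB0 // | xB] := boolP (x \in B).
  have xO : x \in O by rewrite inE.
  by have /ffunP/(_ (exist _ x xO)) := res0; rewrite !ffunE.
apply/ffunP => x; have /ffunP/(_ (val x)) := Lu.
rewrite lap_opE (normal_derivative_interior _ _ w_rho) -/SB SB0 subr0 -/O.
rewrite [X in _ = X]ffunE mulrA => /(canRL (addrK _)) ->.
by rewrite [RHS]ffunE [restr O u x]ffunE scalerBl.
Qed.

Lemma laplace_eigval_gap (R : realType) (V : finType) (G : wgraph R V)
    (B : {set V}) (rho : R) i :
    vertex_boundary G B -> uniform_boundary G B rho -> 0 < rho ->
    (forall a, a \in eigenvalues (lap_op G) ->
       a = 0 \/ rho * meas_of G (~: B) <= a) ->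
    (1 <= i <= #|B|)%N ->
  laplace_eigval G i = if i == 1%N then 0 else rho * meas_of G (~: B).
Proof.
move=> bdry w_rho rho_gt0 gap /andP[i_gt0 i_le].
have B_gt0 : (0 < #|B|)%N by exact: leq_trans i_le.
have [b bB] := card_gt0P B_gt0; have [y yO] := boundary_interior bdry B_gt0.
have VO_gt0 := meas_of_gt0 G yO.
have c_gt0 : 0 < rho * meas_of G (~: B) by rewrite mulr_gt0.
rewrite /laplace_eigval /eigval (nth_sorted_gap (n := (#|B| - 1)%N) c_gt0) //.
- by case: i i_gt0 {i_le} => [|[|i]].
- exact: eigenvalues_sorted.
- rewrite count_eigenvalues -/(lap_op G); apply: (dim_const b) => u.
  rewrite mem_leigenspace scale0r; split=> [/eqP Lu | [c ->]]; last first.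
    exact/eqP/lap_const.
  (* The equation on [B] makes a kernel element equal to its interior mean there, so subtracting
     this mean gives boundary values zero. *)
  pose c : R := vsum (induced G (~: B)) (restr (~: B) u) / meas_of G (~: B).
  exists c; apply/eqP; rewrite -subr_eq0; apply/eqP.
  have Luc : lap_op G (u - [ffun=> c]) = 0.
    by rewrite linearB /= Lu lap_const subr0.
  apply: (harmonic_eq0 w_rho rho_gt0 B_gt0) => x xB.
    have /ffunP/(_ x) := Lu.
    rewrite lap_opE (normal_derivative_boundary _ bdry w_rho xB) ffunE => /eqP.
    rewrite mulf_eq0 (gt_eqF rho_gt0) /= subr_eq0 => /eqP ux.
    by rewrite !ffunE /c -ux mulrC mulKf ?subrr // gt_eqF.
  by rewrite -lap_opE Luc ffunE.
- rewrite count_eigenvalues -/(lap_op G).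
  have ext_lin : linear (@extend R V B 0).
    move=> a f g; apply/ffunP => x; rewrite !ffunE.
    by case: (insub x) => [z|]; rewrite ?ffunE // scaler0 addr0.
  (* Extension by zero is injective and sends mean-zero functions on [B] to eigenfunctions, which
     gives multiplicity at least [#|B| - 1]. *)
  pose E := linfun (@extend R V B 0).
  have EE f : E f = extend 0 f by rewrite linfunE.
  have E_inj : lker E == 0%VS.
    apply/lker0P => f g; rewrite !EE => /(congr1 (restr B)).
    by rewrite !restr_extend.
  have := dim_mean_zero (induced G B); rewrite card_sig => /leq_trans; apply.
  have/limg_dim_eq <- : (lker (linfun (vsum (induced G B))) :&: lker E = 0)%VS.
    by rewrite (eqP E_inj) capv0.
  apply/dimvS/subvP => _ /memv_imgP[f + ->]; rewrite mem_mean_zero => /eqP f0.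
  rewrite EE mem_leigenspace; apply/eqP/ffunP => x; rewrite lap_opE [RHS]ffunE.
  have f0' : vsum (induced G B) (restr B (extend 0 f)) = 0 by rewrite restr_extend.
  have O0 : vsum (induced G (~: B)) (restr (~: B) (extend 0 f)) = 0.
    by rewrite restrC_extend vsum_const mul0r.
  have [xB | xB] := boolP (x \in B).
    by rewrite (normal_derivative_boundary _ bdry w_rho xB) O0 subr0 mulrA.
  have xO : x \in ~: B by rewrite inE.
  rewrite (normal_derivative_interior _ (exist _ x xO) w_rho) f0' restrC_extend.
  by rewrite lap_const ffunE add0r subr0 /= extend_out // !mulr0 scaler0.
- by case: i i_gt0 i_le => // i _ i_le; rewrite leq_subRL ?add1n.
Qed.

(** * The second eigenvalue on the interior and the comparison *)

Lemma mean_zero_card_gt1 (R : realType) (V : finType) (G : wgraph R V) v :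
  v != 0 -> vsum G v = 0 -> (1 < #|V|)%N.
Proof.
move=> v_neq0 v_sum; rewrite ltnNge; apply: contraNN v_neq0 => /card_le1_eqP V1.
apply/eqP/ffunP => x; rewrite ffunE; apply/eqP.
have /eqP : v x * vsum G [ffun=> 1] = 0.
  rewrite -v_sum /vsum mulr_sumr; apply: eq_bigr => y _.
  by rewrite ffunE mulr1 mulrC (V1 x y).
by rewrite mulf_eq0 (gt_eqF (total_meas_gt0 G x)) orbF.
Qed.

(** The indicator of a component is constant along edges, hence in the kernel; minus its mean it is
    a nonzero test function for [laplace_eigval2_le]. *)
Lemma mu2_disconnected (R : realType) (V : finType) (G : wgraph R V) :
  ~ graph_connected G -> mu2 G = 0%:E.
Proof.
move=> G_disc; have [x [y xy]] : exists x y, ~~ connect (adj G) x y.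
  apply: contrapT => no; apply: G_disc => x y; apply: contrapT => /negP xy.
  by apply: no; exists x, y.
pose u : {ffun V -> R^o} := [ffun z => (connect (adj G) x z)%:R].
have V_gt1 : (1 < #|V|)%N.
  apply/card_gt1P; exists x, y; split=> //.
  by apply: contraNneq xy => ->; rewrite connect0.
rewrite /mu2 V_gt1; congr (_%:E); apply: le_anti; apply/andP; split; last first.
  have [v [v_neq0 _]] := laplace_eigval2_eigenvector G V_gt1.
  exact: lap_eigenvalue_ge0.
pose one : {ffun V -> R^o} := [ffun=> 1].
have m_gt0 := total_meas_gt0 G x; rewrite -/one in m_gt0.
have lin := linfunE (vsum_linear G).
pose c := vsum G u / vsum G one.
apply: (@laplace_eigval2_le _ _ G (u - c *: one)).
- apply: contraNneq xy => /eqP; rewrite subr_eq0 => /eqP/ffunP uc.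
  have := uc x; rewrite -[RHS](_ : u y = _); last by rewrite uc !ffunE.
  by rewrite !ffunE connect0; case: connect => // /eqP; rewrite oner_eq0.
- by rewrite -lin linearB linearZ /= !lin /GRing.scale /= divfK ?subrr ?gt_eqF.
rewrite scale0r linearB linearZ /= lap_const scaler0 subr0.
apply/ffunP => z; rewrite lap_opE ffunE /normal_derivative big1 ?mulr0 // => w _.
have [zw | /ewt_eq0 ->] := boolP (adj G z w); last by rewrite mulr0.
suff -> : u z = u w by rewrite subrr mul0r.
rewrite !ffunE; congr ((nat_of_bool _)%:R); apply/idP/idP => /connect_trans; apply.
  exact: connect1.
by apply: connect1; rewrite adj_sym.
Qed.

Theorem corollary1p2 (R : realType) (V : finType) (G : wgraph R V)
    (B : {set V}) (rho : R)
    (G_conn : graph_connected G)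
    (B_bdry : vertex_boundary G B)
    (B_ge2 : (2 <= #|B|)%N)
    (rho_gt0 : 0 < rho)
    (w_rho : forall x y, x \in B -> y \in ~: B ->
               ewt G x y = rho * vmeas G x * vmeas G y) :
  let Omega := ~: B in
  let V_B := \sum_(x in B) vmeas G x in
  let V_Omega := \sum_(y in Omega) vmeas G y in
  ((forall i, (1 <= i <= #|B|)%N -> steklov_eigval G B i = laplace_eigval G i)
     <-> ((rho * (V_Omega - V_B))%:E <= mu2 (induced G Omega))%E)
  /\
  (~ graph_connected (induced G Omega) ->
     ((forall i, (1 <= i <= #|B|)%N -> steklov_eigval G B i = laplace_eigval G i)
        <-> V_Omega <= V_B)).
Proof.
move=> Omega V_B V_Omega.
have B_gt0 : (0 < #|B|)%N by exact: ltnW.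
have [b bB] := card_gt0P B_gt0.
have VB_gt0 : 0 < V_B := meas_of_gt0 G bB.
have main : (forall i, (1 <= i <= #|B|)%N ->
      steklov_eigval G B i = laplace_eigval G i) <->
    ((rho * (V_Omega - V_B))%:E <= mu2 (induced G Omega))%E.
  split=> [eig_eq | mu2_ge].
    rewrite /mu2; case: ifPn => [O_gt1 | _]; last exact: leey.
    have [v [v_neq0 v_sum Lv]] := laplace_eigval2_eigenvector (induced G Omega) O_gt1.
    rewrite lee_fin leNgt; apply/negP => mu_lt.
    (* If the inequality fails, extending [v] by zero gives an eigenvalue of [G] below the second
       Steklov eigenvalue, against the equality at [i = 2], available since [B] has two elements. *)
    have mu_ge0 := lap_eigenvalue_ge0 v_neq0 Lv.
    set mu := laplace_eigval _ 2 in mu_lt mu_ge0 Lv.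
    pose a := mu + rho * V_B.
    have La : lap_op G (extend 0 v) = a *: extend 0 v.
      exact: (lap_extend0 B_bdry w_rho v_sum Lv).
    have : laplace_eigval G 2 <= a.
      apply: sorted_second_le (eigenvalues_sorted _) _ (zero_lap_eigenvalue G b) _ _.
      - exact: lap_eigenvalues_ge0.
      - apply/mem_eigenvalues; exists (extend 0 v) => //.
        apply: contraNneq v_neq0 => /(congr1 (restr Omega)).
        by rewrite restr_extend => ->; apply/eqP/ffunP => x; rewrite !ffunE.
      (* Here [a] is positive, so no second copy of 0 is required. *)
      - by move=> a0; have := mulr_gt0 rho_gt0 VB_gt0; rewrite /a in a0; lra.
    rewrite -eig_eq // (steklov_eigval_uniform B_bdry w_rho rho_gt0) //=.
    rewrite leNgt => /negP; apply; rewrite -/Omega -/V_Omega /a.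
    by rewrite mulrBr in mu_lt; rewrite -ltrBrDr.
  move=> i i_B; rewrite (steklov_eigval_uniform B_bdry w_rho rho_gt0) //.
  rewrite (laplace_eigval_gap B_bdry w_rho rho_gt0) // => a.
  move=> /mem_eigenvalues[u u_neq0 Lu].
  have [-> | a_neq0] := eqVneq a 0; [by left | right].
  (* An eigenvalue in the gap would give the interior the eigenvalue [a - rho * V_B], below the
     assumed bound; the eigenvector [v] also excludes the value +oo of [mu2]. *)
  rewrite leNgt; apply/negP => a_lt.
  have [v [v_neq0 v_sum Lv]] :=
    small_eigenvector_restr B_bdry w_rho rho_gt0 B_gt0 u_neq0 Lu a_neq0 a_lt.
  move: mu2_ge; rewrite /mu2 (mean_zero_card_gt1 v_neq0 v_sum) lee_fin.
  have /[swap]/le_trans/[apply] := laplace_eigval2_le v_neq0 v_sum Lv.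
  by rewrite mulrBr lerD2r leNgt a_lt.
split=> // O_disc; rewrite main mu2_disconnected // lee_fin.
by rewrite pmulr_rle0 // subr_le0.
Qed.
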